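(* Let $N$ be a horizontally strictly convex homogeneous norm on $\mathbb{H}^n$. Then $N$ has the midpoint property.
   Context: For $n\geq 1$, the Heisenberg group $\mathbb{H}^n$ is the set $\mathbb{R}^{2n}\times\mathbb{R}$ with group law $(z,t)\ast(z',t')=(z+z',\,t+t'+2\omega_n(z,z'))$, where $\omega_n(z,z')=\langle z,J_nz'\rangle$, $J_n=\begin{pmatrix}0&-E_n\\ E_n&0\end{pmatrix}$ and $E_n$ is the $n\times n$ identity matrix. The neutral element is $e=(0,0)$ and $(z,t)^{-1}=(-z,-t)$. For $\lambda>0$ the dilation is $\delta_\lambda(z,t)=(\lambda z,\lambda^2t)$. A homogeneous norm on $\mathbb{H}^n$ is a function $N:\mathbb{H}^n\to[0,\infty)$ with $N(p)=0\Leftrightarrow p=e$, $N(p^{-1})=N(p)$, $N(p\ast q)\leq N(p)+N(q)$ and $N(\delta_\lambda(p))=\lambda N(p)$ for all $p,q\in\mathbb{H}^n$, $\lambda>0$. It induces the left-invariant metric $d_N(p,q)=N(p^{-1}\ast q)$. $N$ is horizontally strictly convex if for all $p,p'\in\mathbb{H}^n\setminus\{e\}$ with $N(p\ast p')=N(p)+N(p')$ there exist $z\in\mathbb{R}^{2n}\setminus\{0\}$ and $s,s'\in\mathbb{R}$ such that $p=(sz,0)$ and $p'=(s'z,0)$. $N$ has the midpoint property if for all $p_1,p_2,q\in\mathbb{H}^n$: $d_N(p_1,p_2)=2d_N(p_1,q)=2d_N(p_2,q)$ implies $q=\frac{p_1+p_2}{2}$, where addition and scalar multiplication are those of the vector space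 $\mathbb{R}^{2n+1}$. *)

(* Defs.v *)
From HB Require Import structures.
From mathcomp Require Import all_boot all_order all_algebra.
From mathcomp Require Import reals.

Set Implicit Arguments.
Unset Strict Implicit.
Unset Printing Implicit Defensive.

Import Order.TTheory GRing.Theory Num.Theory.
Local Open Scope ring_scope.

(* The second factor is R^o rather than R so that heis R n inherits from the
   library the vector-space structure of R^{2n+1}: +, -, 0 and *: on heis R n
   are the linear operations, never the group law. *)
Definition heis (R : realType) (n : nat) : lmodType R :=
  ('cV[R]_(n + n) * R^o)%type.

Definition Jmx (R : realType) (n : nat) : 'M[R]_(n + n) :=
  block_mx 0 (- 1%:M) 1%:M 0.

Definition dotp (R : realType) (m : nat) (x y : 'cV[R]_m) : R :=
  \sum_(i < m) x i 0 * y i 0.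

Definition omega (R : realType) (n : nat) (z z' : 'cV[R]_(n + n)) : R :=
  dotp z (Jmx R n *m z').

Definition hmul (R : realType) (n : nat) (p q : heis R n) : heis R n :=
  (p.1 + q.1, p.2 + q.2 + 2 * omega p.1 q.1).

Definition hone (R : realType) (n : nat) : heis R n := (0, 0).

Definition hinv (R : realType) (n : nat) (p : heis R n) : heis R n :=
  (- p.1, - p.2).

Definition hdil (R : realType) (n : nat) (l : R) (p : heis R n) : heis R n :=
  (l *: p.1, l ^+ 2 * p.2).

Record homogeneous_norm (R : realType) (n : nat) (N : heis R n -> R) : Prop :=
  HomogeneousNorm {
    hnorm_ge0 : forall p, 0 <= N p;
    hnorm_eq0 : forall p, N p = 0 <-> p = hone R n;
    hnorm_inv : forall p, N (hinv p) = N p;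
    hnorm_mul : forall p q, N (hmul p q) <= N p + N q;
    hnorm_dil : forall p l, 0 < l -> N (hdil l p) = l * N p
  }.

Definition hdist (R : realType) (n : nat) (N : heis R n -> R)
    (p q : heis R n) : R :=
  N (hmul (hinv p) q).

Definition horizontally_strictly_convex (R : realType) (n : nat)
    (N : heis R n -> R) : Prop :=
  forall p p' : heis R n, p <> hone R n -> p' <> hone R n ->
    N (hmul p p') = N p + N p' ->
    exists (z : 'cV[R]_(n + n)) (s s' : R),
      [/\ z <> 0, p = (s *: z, 0) & p' = (s' *: z, 0)].

Definition midpoint_property (R : realType) (n : nat)
    (N : heis R n -> R) : Prop :=
  forall p1 p2 q : heis R n,
    hdist N p1 p2 = 2 * hdist N p1 q ->
    2 * hdist N p1 q = 2 * hdist N p2 q ->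
    q = 2^-1 *: (p1 + p2).

(* Main.v *)
Require Import Defs.
From mathcomp Require Import all_boot all_order all_algebra.
From mathcomp Require Import reals.
From mathcomp Require Import ring lra.

(** Write [a = p1^-1 * q] and [b = q^-1 * p2].  The two distance equations say
    [N a = N b] and [N (a * b) = N a + N b], so [a] and [b] realise equality
    in the triangle inequality.  If [a] or [b] is trivial, then
    [p1 = q = p2].  Otherwise strict convexity puts [a] and [b] on a common
    horizontal line, [a = (s z, 0)] and [b = (s' z, 0)]; homogeneity and
    [N a = N b] give [|s| = |s'|], and [s' = - s] is excluded because it would
    make [a * b] trivial ([equal_norm_horizontal]).

    Hence [a = b = (w, 0)], so that [q = p1 * (w, 0)] and [p2 = q * (w, 0)].
    The symplectic form is alternating, so [(w, 0) * (w, 0) = (2 w, 0)] and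
    [p1], [q], [p2] lie on the curve [x |-> p1 * (x w, 0)] at parameters 0, 1
    and 2.  By bilinearity this curve is affine in [x]: it is a straight line
    of the underlying vector space, and [q] is the linear midpoint
    ([horizontal_midpoint]). *)

Import Order.TTheory GRing.Theory Num.Theory.
Local Open Scope ring_scope.

(** The matrix form gives bilinearity and the behaviour under transposition. *)
Lemma omegaE {R : realType} {n : nat} (z w : 'cV[R]_(n + n)) :
  omega z w = (z^T *m (Jmx R n *m w)) 0 0.
Proof.
rewrite /omega /dotp [RHS]mxE.
by apply: eq_bigr => i _; rewrite [z^T _ _]mxE.
Qed.

Lemma omegaDl {R : realType} {n : nat} (z z' w : 'cV[R]_(n + n)) :
  omega (z + z') w = omega z w + omega z' w.
Proof. by rewrite !omegaE linearD mulmxDl mxE. Qed.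

Lemma omegaDr {R : realType} {n : nat} (z w w' : 'cV[R]_(n + n)) :
  omega z (w + w') = omega z w + omega z w'.
Proof. by rewrite !omegaE !mulmxDr mxE. Qed.

Lemma omegaNl {R : realType} {n : nat} (z w : 'cV[R]_(n + n)) :
  omega (- z) w = - omega z w.
Proof. by rewrite !omegaE linearN mulNmx mxE. Qed.

Lemma omegaNr {R : realType} {n : nat} (z w : 'cV[R]_(n + n)) :
  omega z (- w) = - omega z w.
Proof. by rewrite !omegaE !mulmxN mxE. Qed.

Lemma trmx_Jmx (R : realType) (n : nat) : (Jmx R n)^T = - Jmx R n.
Proof.
by rewrite /Jmx tr_block_mx opp_block_mx !trmx0 linearN /= trmx1 oppr0 opprK.
Qed.

Lemma omegaC {R : realType} {n : nat} (z w : 'cV[R]_(n + n)) :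
  omega z w = - omega w z.
Proof.
(* A 1 x 1 matrix is its own transpose. *)
have -> : omega z w = (z^T *m (Jmx R n *m w))^T 0 0 by rewrite mxE omegaE.
by rewrite !trmx_mul trmxK trmx_Jmx mulmxN mulNmx mxE omegaE mulmxA.
Qed.

Lemma omegaxx {R : realType} {n : nat} (z : 'cV[R]_(n + n)) : omega z z = 0.
Proof. by have := omegaC z z; lra. Qed.

Lemma hmulA {R : realType} {n : nat} (p q r : heis R n) :
  hmul p (hmul q r) = hmul (hmul p q) r.
Proof.
by rewrite /hmul /= omegaDl omegaDr addrA; congr (_, _); rewrite !mulrDr; ring.
Qed.

Lemma hmulKV {R : realType} {n : nat} (p q : heis R n) :
  hmul p (hmul (hinv p) q) = q.
Proof.
case: p q => z t [w u]; rewrite /hmul /hinv /= omegaDr omegaNl omegaNr omegaxx.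
by congr (_, _); [rewrite addNKr|ring].
Qed.

Lemma hmulpV {R : realType} {n : nat} (p : heis R n) :
  hmul p (hinv p) = hone R n.
Proof.
case: p => z t; rewrite /hmul /hinv /= omegaNr omegaxx subrr.
by congr (_, _); ring.
Qed.

Lemma hinv_hmul {R : realType} {n : nat} (p q : heis R n) :
  hinv (hmul p q) = hmul (hinv q) (hinv p).
Proof.
rewrite /hmul /hinv /= omegaNl omegaNr opprK (omegaC q.1).
by congr (_, _); [rewrite opprD addrC|ring].
Qed.

Lemma hinvK {R : realType} {n : nat} (p : heis R n) : hinv (hinv p) = p.
Proof. by case: p => z t; rewrite /hinv /= !opprK. Qed.

Lemma hdistC {R : realType} {n : nat} {N : heis R n -> R}
    (hN : homogeneous_norm N) (p q : heis R n) :
  hdist N p q = hdist N q p.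
Proof. by rewrite /hdist -(hnorm_inv hN) hinv_hmul hinvK. Qed.

(** On the horizontal layer a dilation is a linear scaling and the group
    inverse is the linear opposite; the inverse supplies the negative
    scalars. *)
Lemma hnorm_horizontal {R : realType} {n : nat} {N : heis R n -> R}
    (hN : homogeneous_norm N) (s : R) (z : 'cV[R]_(n + n)) :
  N (s *: z, 0) = `|s| * N (z, 0).
Proof.
have pos (l : R) (l0 : 0 < l) : N (l *: z, 0) = l * N (z, 0).
  by rewrite -(hnorm_dil hN) // /hdil /= mulr0.
case: (ltrgt0P s) => [s0|s0|->]; first exact: pos.
  by rewrite -(hnorm_inv hN) /hinv /= oppr0 -scaleNr pos ?oppr_gt0.
by rewrite scale0r mul0r; apply/(hnorm_eq0 hN).
Qed.

(** The second step contributes [2 * omega (z + w) w = 2 * omega z w], the same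
    vertical increment as the first, because [omega w w = 0]. *)
Lemma horizontal_midpoint {R : realType} {n : nat} (p : heis R n)
    (w : 'cV[R]_(n + n)) :
  hmul p (w, 0) = 2^-1 *: (p + hmul (hmul p (w, 0)) (w, 0)).
Proof.
case: p => z t; rewrite /hmul /= omegaDl omegaxx.
have half (V : lmodType R) (x y : V) : x + y = 2^-1 *: (x + (x + y + y)).
  have -> : x + (x + y + y) = 2 *: (x + y).
    by rewrite scaler_nat mulr2n -[RHS]addrA (addrC y).
  by rewrite scalerA mulVf ?scale1r // pnatr_eq0.
congr (_, _); first exact: half.
by rewrite /= /GRing.scale /=; field.
Qed.

(** Equality of the norms fixes the scalars of strict convexity up to sign,
    and the opposite sign would make the product trivial. *)
Lemma equal_norm_horizontal {R : realType} {n : nat} {N : heis R n -> R}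
    (hN : homogeneous_norm N) (hconv : horizontally_strictly_convex N)
    (a b : heis R n) :
  N a = N b -> N (hmul a b) = N a + N b ->
  exists w : 'cV[R]_(n + n), a = (w, 0) /\ b = (w, 0).
Proof.
move=> Nab Nmul.
have [Na0|/eqP Na0] := eqVneq (N a) 0.
  exists 0; split; apply/(hnorm_eq0 hN) => //; by rewrite -Nab.
have a1 : a <> hone R n by move/(hnorm_eq0 hN).
have b1 : b <> hone R n by move/(hnorm_eq0 hN); rewrite -Nab.
have [z [s [s' [z0 Ea Eb]]]] := hconv a b a1 b1 Nmul.
have Nz : N (z, 0) != 0.
  by apply/eqP => /(hnorm_eq0 hN) [].
have : `|s| = `|s'|.
  apply: (mulIf Nz).
  by rewrite -!(hnorm_horizontal hN) -Ea -Eb.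
move/eqP; rewrite eqr_norm2 => /orP[/eqP Es|/eqP Es].
  by exists (s *: z); split=> //; rewrite Eb Es.
have Ev : b = hinv a.
  by rewrite Ea Eb Es /hinv /= oppr0 scaleNr opprK.
case: Na0; move: Nmul; rewrite Ev hmulpV (hnorm_inv hN).
have -> : N (hone R n) = 0 by apply/(hnorm_eq0 hN).
by move=> ?; lra.
Qed.

Theorem proposition3p7 (R : realType) (n : nat) (hn : (1 <= n)%N)
    (N : heis R n -> R) (hN : homogeneous_norm N)
    (hconv : horizontally_strictly_convex N) :
  midpoint_property N.
Proof.
move=> p1 p2 q D12 Dq.
have Eq : N (hmul (hinv p1) q) = N (hmul (hinv q) p2).
  by rewrite -/(hdist N p1 q) -/(hdist N q p2) (hdistC hN q); lra.
have Emul : N (hmul (hmul (hinv p1) q) (hmul (hinv q) p2))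
    = N (hmul (hinv p1) q) + N (hmul (hinv q) p2).
  by rewrite -hmulA hmulKV -Eq -!/(hdist N _ _) D12; ring.
have [w [Ea Eb]] := equal_norm_horizontal hN hconv _ _ Eq Emul.
have Hq : q = hmul p1 (w, 0) by rewrite -Ea hmulKV.
have Hp2 : p2 = hmul q (w, 0) by rewrite -Eb hmulKV.
by rewrite Hp2 Hq -horizontal_midpoint.
Qed.
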